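(* Let $\Gamma\subset PGL_{2n+2}(\mathbb{C})$ be a group of type $\mathcal{L}$ and let $(\sigma_\nu)$ be a sequence of distinct elements of $\Gamma$. Then there exist limit $n$-planes $\ell_I,\ell_K$ of $\Gamma$ and a subsequence $(\tau_\nu)$ of $(\sigma_\nu)$ such that for every compact set $M\subset\mathbb{P}^{2n+1}\setminus|\ell_K|$ and every neighborhood $V$ of $|\ell_I|$ there is an integer $m_0$ with $\tau_\nu(M)\subset V$ for all $\nu>m_0$.
   Context: Fix $n\geq1$. An $n$-plane is an $n$-dimensional projective linear subspace of $\mathbb{P}^{2n+1}$; $|\ell|$ denotes its point set. Let $N=\binom{2n+2}{n+1}-1$, $\mathbb{P}^N=\mathbb{P}(\Lambda^{n+1}\mathbb{C}^{2n+2})$, and $\mathcal{G}\subset\mathbb{P}^N$ the Grassmannian $Gr(n+1,2n+2)$ embedded by Plücker coordinates; $\hat\ell\in\mathcal{G}$ is the point of an $n$-plane $\ell$. Each $\sigma\in PGL_{2n+2}(\mathbb{C})$ induces $\hat\sigma\in PGL_{N+1}(\mathbb{C})$ via $\Lambda^{n+1}$ of a representative. For a sequence $(\tau_\nu)$ of pairwise distinct elements of $PGL_{m+1}(\mathbb{C})$, pick representatives in $GL_{m+1}(\mathbb{C})$ whose largest entry in absolute value is $1$; if they can be chosen to converge to $T\in M_{m+1}(\mathbb{C})$, the limit image is $\mathbb{P}(\operatorname{Im}T)$ and the limit kernel $\mathbb{P}(\operatorname{Ker}T)$. For a discrete $\Gamma\subset PGL_{2n+2}(\mathbb{C})$, a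 sequence $(\sigma_\nu)\subset\Gamma$ is normal if it consists of distinct elements and both $(\sigma_\nu)$ and $(\hat\sigma_\nu)$ admit such convergent normalized representatives. An $n$-plane $\ell$ is a limit $n$-plane of $\Gamma$ if $\hat\ell\in\mathcal{G}\cap I(\hat\sigma_\nu)$ for some normal sequence, $I(\hat\sigma_\nu)$ being the limit image of $(\hat\sigma_\nu)$. $\Lambda(\Gamma)$ is the union of $|\ell|$ over limit $n$-planes, $\Omega(\Gamma)=\mathbb{P}^{2n+1}\setminus\Lambda(\Gamma)$. A domain is large if it contains an $n$-plane; a discrete subgroup $\Gamma$ is of type $\mathcal{L}$ if $\Omega(\Gamma)$ contains a large domain. *)

(* Defs.v *)
From HB Require Import structures.
From mathcomp Require Import all_boot all_order all_algebra.
From mathcomp Require Import all_classical all_reals all_analysis.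
From mathcomp Require Import complex.
From mathcomp Require Import Rstruct Rstruct_topology.
Import numFieldTopology.Exports numFieldNormedType.Exports.

Set Implicit Arguments.
Unset Strict Implicit.
Unset Printing Implicit Defensive.

Import Order.TTheory GRing.Theory Num.Theory.
Local Open Scope classical_set_scope.
Local Open Scope ring_scope.

(* The complex numbers C = R[i], R the (Stdlib) real numbers.  Declared as a
   numClosedFieldType so that MathComp-Analysis' (metric) topology on
   numeric fields applies; matrices/row vectors over C carry the product
   topology. *)
Definition C : numClosedFieldType := complex Rdefinitions.R.

Definition dim2 (n : nat) : nat := n.*2.+2.

(* Convention: points of P^m are nonzero ROW vectors 'rV[C]_(m+1) up to
   nonzero scalars, and a matrix A acts by v |-> v *m A.  A subset of P^m is
   represented by its (saturated) cone of nonzero representatives. *)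

Definition proj_eq (m : nat) (A B : 'M[C]_m) : Prop :=
  exists c : C, c != 0 /\ A = c *: B.

Definition normalized (m : nat) (A : 'M[C]_m) : Prop :=
  (forall i j, `|A i j| <= 1) /\ (exists i j, `|A i j| = 1).

Definition has_limit (m : nat) (A : nat -> 'M[C]_m) (T : 'M[C]_m) : Prop :=
  exists c : nat -> C,
    (forall nu, c nu != 0) /\ (forall nu, normalized (c nu *: A nu)) /\
    (fun nu => c nu *: A nu) @ \oo --> T.

Definition pidx (n : nat) := {S : {set 'I_(dim2 n)} | #|S| == n.+1}.

Definition sel (n : nat) (S : pidx n) (i : 'I_n.+1) : 'I_(dim2 n) :=
  nth ord0 (enum (val S)) i.

(* matrix of Lambda^{n+1} A (compound matrix) in the basis indexed by pidx n *)
Definition compound (n : nat) (A : 'M[C]_(dim2 n)) : 'M[C]_(#|{: pidx n}|) :=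
  \matrix_(i, j) \det (mxsub (sel (enum_val i)) (sel (enum_val j)) A).

(* an n-plane is the projectivized row space of a rank-(n+1) matrix B *)
Definition nplane (n : nat) (B : 'M[C]_(n.+1, dim2 n)) : Prop :=
  \rank B = n.+1.

Definition pts (n : nat) (B : 'M[C]_(n.+1, dim2 n)) : set 'rV[C]_(dim2 n) :=
  [set v | v != 0 /\ (v <= B)%MS].

Definition plucker (n : nat) (B : 'M[C]_(n.+1, dim2 n)) : 'rV[C]_(#|{: pidx n}|) :=
  \row_j \det (colsub (sel (enum_val j)) B).

(* G is the set of all representatives in GL of a subgroup of PGL *)
Definition pgl_subgroup (m : nat) (G : set 'M[C]_m) : Prop :=
  [/\ (forall A, G A -> A \in unitmx),
      G 1%:M,
      (forall A (c : C), G A -> c != 0 -> G (c *: A)),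
      (forall A B, G A -> G B -> G (A *m B)) &
      (forall A, G A -> G (invmx A))].

(* discreteness in PGL: every element of the group is isolated (open sets of
   PGL are lifted to open sets of matrices) *)
Definition pgl_discrete (m : nat) (G : set 'M[C]_m) : Prop :=
  forall A, G A -> exists U : set 'M[C]_m,
    [/\ open U, U A & forall B, G B -> U B -> proj_eq B A].

Definition normal_seq (n : nat) (G : set 'M[C]_(dim2 n))
    (s : nat -> 'M[C]_(dim2 n)) : Prop :=
  [/\ (forall nu, G (s nu)),
      (forall nu mu, nu <> mu -> ~ proj_eq (s nu) (s mu)),
      (exists T, has_limit s T) &
      (exists T, has_limit (fun nu => compound (s nu)) T)].

Definition limit_plane (n : nat) (G : set 'M[C]_(dim2 n))
    (B : 'M[C]_(n.+1, dim2 n)) : Prop :=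
  nplane B /\
  exists (s : nat -> 'M[C]_(dim2 n)) (T : 'M[C]_(#|{: pidx n}|)),
    [/\ normal_seq G s, has_limit (fun nu => compound (s nu)) T &
        (plucker B <= T)%MS].

Definition Lambda (n : nat) (G : set 'M[C]_(dim2 n)) : set 'rV[C]_(dim2 n) :=
  [set v | exists B, limit_plane G B /\ pts B v].

Definition Omega (n : nat) (G : set 'M[C]_(dim2 n)) : set 'rV[C]_(dim2 n) :=
  [set v | v != 0 /\ ~ Lambda G v].

Definition psat (m : nat) (S : set 'rV[C]_m) : Prop :=
  forall v, S v -> v != 0 /\ forall c : C, c != 0 -> S (c *: v).

Definition popen (m : nat) (S : set 'rV[C]_m) : Prop := psat S /\ open S.

Definition pconnected (m : nat) (S : set 'rV[C]_m) : Prop :=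
  psat S /\
  forall U1 U2, popen U1 -> popen U2 -> S `<=` U1 `|` U2 ->
    S `&` U1 `&` U2 = set0 -> S `<=` U1 \/ S `<=` U2.

Definition pcompact (m : nat) (S : set 'rV[C]_m) : Prop :=
  psat S /\
  forall (I : Type) (U : I -> set 'rV[C]_m), (forall i, popen (U i)) ->
    S `<=` \bigcup_i U i ->
    exists F : set I, finite_set F /\ S `<=` \bigcup_(i in F) U i.

Definition pnbhd (m : nat) (V A : set 'rV[C]_m) : Prop :=
  psat V /\ exists O, [/\ popen O, A `<=` O & O `<=` V].

Definition large_domain (n : nat) (D : set 'rV[C]_(dim2 n)) : Prop :=
  [/\ popen D, pconnected D &
      exists B : 'M[C]_(n.+1, dim2 n), nplane B /\ pts B `<=` D].

Definition typeL (n : nat) (G : set 'M[C]_(dim2 n)) : Prop :=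
  [/\ pgl_subgroup G, pgl_discrete G &
      exists D, large_domain D /\ D `<=` Omega G].

(* Main.v *)
(* Write s_nu = U_nu D_nu W_nu with U_nu, W_nu unitary and D_nu the diagonal of
   the decreasing singular values a_0 >= a_1 >= ..., and pass to a subsequence
   along which U_nu, W_nu and a_{n+1}/a_n converge (to U, W and r).
   By Cauchy-Binet the compound matrix acts on Pluecker coordinates, and its
   norm is comparable with a_0 ... a_n.  Hence, if r <> 0, every plane spanned
   by e_0, ..., e_{n-1} and a vector of <e_n, e_{n+1}> is mapped by W to a limit
   plane.  These planes sweep out an (n+2)-dimensional subspace, which meets
   every n-plane, contradicting the large domain in Omega.  So r = 0: then
   s_nu contracts everything away from l_K = <e_{n+1}, ..., e_{2n+1}> U^-1 towards
   l_I = <e_0, ..., e_n> W, and l_K is a limit plane because it is the "l_I" of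
   the inverse sequence. *)
Require Import Defs.
From HB Require Import structures.
From mathcomp Require Import all_boot all_order all_algebra all_fingroup.
From mathcomp Require Import all_classical all_reals all_analysis.
From mathcomp Require Import complex Rstruct Rstruct_topology ring.
Import numFieldTopology.Exports numFieldNormedType.Exports.
Import Order.TTheory GRing.Theory Num.Theory.
Set Implicit Arguments.
Unset Strict Implicit.
Unset Printing Implicit Defensive.
Local Open Scope classical_set_scope.
Local Open Scope ring_scope.

(** * Cauchy-Binet and Pluecker coordinates *)

Section CauchyBinet.
Variable n : nat.
Implicit Types S : pidx n.

Lemma size_pidx S : size (enum (val S)) = n.+1.
Proof. by rewrite -cardE (eqP (valP S)). Qed.

Lemma sel_in S i : sel S i \in val S.
Proof. by rewrite -mem_enum; apply: mem_nth; rewrite size_pidx. Qed.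

Lemma sel_inj S : injective (sel S).
Proof.
move=> i j /eqP; rewrite /sel nth_uniq ?size_pidx ?enum_uniq //.
by move/eqP/val_inj.
Qed.

(** The permutation sends [i] to the position of [f i] in the increasing enumeration of [S]. *)
Lemma sel_perm S (f : {ffun 'I_n.+1 -> 'I_(dim2 n)}) :
  injective f -> [set f i | i in 'I_n.+1]%SET = val S ->
  exists p : 'S_n.+1, f = [ffun i => sel S (p i)].
Proof.
move=> f_inj fS.
have fin i : f i \in enum (val S) by rewrite mem_enum -fS imset_f.
have lt_i i : (index (f i) (enum (val S)) < n.+1)%N.
  by have := fin i; rewrite -index_mem size_pidx.
have g_inj : injective (fun i => Ordinal (lt_i i)).
  move=> i j /(congr1 val) /= /(congr1 (nth ord0 (enum (val S)))).
  by rewrite !nth_index // => /f_inj.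
exists (perm g_inj); apply/ffunP=> i; rewrite ffunE permE /sel /=.
by rewrite nth_index.
Qed.

(** Multilinearity in the rows of the product, each a combination of rows of [Y]. At this stage [f]
    may repeat values. *)
Lemma det_mulmx_ffun (R : comPzRingType) k d
    (X : 'M[R]_(k, d)) (Y : 'M[R]_(d, k)) :
  \det (X *m Y) =
    \sum_(f : {ffun 'I_k -> 'I_d}) (\prod_i X i (f i)) * \det (rowsub f Y).
Proof.
rewrite /determinant; under eq_bigr => s _.
  under eq_bigr => i _ do rewrite mxE.
  rewrite bigA_distr_bigA /= big_distrr /=; over.
rewrite exchange_big /=; apply: eq_bigr => f _; rewrite big_distrr /=.
apply: eq_bigr => s _; rewrite big_split /= mulrCA; congr (_ * (_ * _)).
by apply: eq_bigr => i _; rewrite !mxE.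
Qed.

(** Maps [f] with a repeated value contribute nothing. The injective ones are grouped by image, and
    the sum over all orderings of one image rebuilds the minor of [X]. *)
Theorem cauchy_binet (R : comNzRingType)
    (X : 'M[R]_(n.+1, dim2 n)) (Y : 'M[R]_(dim2 n, n.+1)) :
  \det (X *m Y) =
    \sum_(j < #|{: pidx n}|)
      \det (colsub (sel (enum_val j)) X) * \det (rowsub (sel (enum_val j)) Y).
Proof.
pose F (f : {ffun 'I_n.+1 -> 'I_(dim2 n)}) :=
  (\prod_i X i (f i)) * \det (rowsub f Y).
pose Q (f : {ffun 'I_n.+1 -> 'I_(dim2 n)}) (j : 'I_#|{: pidx n}|) :=
  injectiveb f && ([set f i | i in 'I_n.+1]%SET == val (enum_val j)).
(* The term of [f] is spread over the indices [j] of its image: exactly one if [f] is injective,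
   none otherwise. The two sums can then be exchanged. *)
rewrite det_mulmx_ffun (eq_bigr (fun f => \sum_(j | Q f j) F f)) => [|f _].
  rewrite (exchange_big_dep predT) //=; apply: eq_bigr => j _.
  set S := enum_val j.
  pose h (p : 'S_n.+1) := [ffun i => sel S (p i)] : {ffun _ -> _}.
  have h_inj : injective h.
    move=> p q /ffunP hpq; apply/permP => i; apply: (@sel_inj S).
    by have := hpq i; rewrite !ffunE.
  rewrite (reindex_omap h (fun f => [pick p | h p == f])) /=; last first.
    move=> f /andP[/injectiveP f_inj /eqP fS].
    have [p fp] := sel_perm f_inj fS.
    case: pickP => [q /eqP <- //|/(_ p)].
    by rewrite -/(h p) in fp; rewrite fp eqxx.
  rewrite (eq_bigl predT) => [|p]; last first.
    apply/andP; split; last first.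
      by case: pickP => [q /eqP/h_inj -> //|/(_ p)]; rewrite eqxx.
    have hp_inj : injective (h p).
      by move=> i k; rewrite !ffunE => /sel_inj /perm_inj.
    apply/andP; split; first exact/injectiveP.
    rewrite eqEcard card_imset // (eqP (valP S)) card_ord leqnn andbT.
    by apply/fintype.subsetP => _ /imsetP[i _ ->]; rewrite ffunE sel_in.
  rewrite [\det (colsub _ _)]/determinant big_distrl /=.
  apply: eq_bigr => p _; rewrite /F.
  have -> : rowsub (h p) Y = row_perm p (rowsub (sel S) Y).
    by apply/matrixP => a b; rewrite !mxE ffunE.
  rewrite row_permE det_mulmx det_perm mulrA; congr (_ * _).
  rewrite mulrC; congr (_ * _).
  by apply: eq_bigr => i _; rewrite mxE ffunE.
have [/injectiveP f_inj|f_ninj] := boolP (injectiveb f).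
  have Sf : #|[set f i | i in 'I_n.+1]%SET| == n.+1.
    by rewrite card_imset // card_ord.
  pose Sf' : pidx n := exist (fun S : {set _} => #|S| == n.+1) _ Sf.
  rewrite (big_pred1 (enum_rank Sf')) // => j.
  rewrite /Q (introT (injectiveP _) f_inj) /=.
  apply/eqP/eqP => [fS|->]; last by rewrite enum_rankK.
  by rewrite -(enum_valK j); congr enum_rank; apply: val_inj.
rewrite [RHS]big_pred0 => [|j]; last by rewrite /Q (negbTE f_ninj).
suff -> : \det (rowsub f Y) = 0 by rewrite mulr0.
have /injectivePn[i [j ij fij]] := f_ninj.
by apply: (determinant_alternate ij) => b; rewrite !mxE fij.
Qed.

Lemma plucker_mul (X : 'M[C]_(n.+1, dim2 n)) (A : 'M[C]_(dim2 n)) :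
  plucker (X *m A) = plucker X *m compound A.
Proof.
apply/rowP => j; rewrite !mxE.
have -> : colsub (sel (enum_val j)) (X *m A) = X *m colsub (sel (enum_val j)) A.
  by rewrite mulmx_colsub.
rewrite cauchy_binet; apply: eq_bigr => i _; rewrite !mxE.
congr (_ * \det _); by apply/matrixP => a b; rewrite !mxE.
Qed.

(** The rows of a compound matrix are Pluecker vectors of row selections, so this reduces to
    [plucker_mul]. *)
Lemma compoundM (A B : 'M[C]_(dim2 n)) :
  compound (A *m B) = compound A *m compound B.
Proof.
have cE (D : 'M[C]_(dim2 n)) i :
    row i (compound D) = plucker (rowsub (sel (enum_val i)) D).
  by apply/rowP => j; rewrite !mxE; congr (\det _); apply/matrixP => a b; rewrite !mxE.
by apply/row_matrixP => i; rewrite row_mul !cE -mul_rowsub_mx plucker_mul.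
Qed.

Lemma plucker_scale_rows (r : 'rV[C]_n.+1) (X : 'M[C]_(n.+1, dim2 n)) :
  plucker (diag_mx r *m X) = (\prod_i r 0 i) *: plucker X.
Proof.
apply/rowP => j; rewrite !mxE -mulmx_colsub det_mulmx det_diag.
by [].
Qed.

(** Otherwise Cauchy-Binet would write [\det 1%:M] as a sum of zeros. *)
Lemma plucker_neq0 (X : 'M[C]_(n.+1, dim2 n)) (Z : 'M[C]_(dim2 n, n.+1)) :
  X *m Z = 1%:M -> plucker X != 0.
Proof.
move=> XZ; apply/eqP => X0; have := cauchy_binet X Z.
rewrite XZ det1 big1 => [/eqP|j _]; first by rewrite oner_eq0.
by have /rowP/(_ j) := X0; rewrite !mxE => ->; rewrite mul0r.
Qed.

(** A strictly increasing sequence of naturals dominates its index. This makes a_0 ... a_n the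
    dominant product in [compound_diag_bound]. *)
Lemma leq_sel S (i : 'I_n.+1) : (i <= sel S i)%N.
Proof.
have srt : sorted ltn (map val (enum (val S))).
  rewrite -[enum _](eq_filter (mem_enum _)).
  rewrite -(eq_filter (mem_map val_inj _)) -filter_map.
  by rewrite (sorted_filter ltn_trans) // unlock val_ord_enum iota_ltn_sorted.
suff H m : (m < n.+1)%N -> (m <= nth ord0 (enum (val S)) m)%N by exact: H.
elim: m => // m IHm lt_m; apply: leq_ltn_trans (IHm (ltnW lt_m)) _.
rewrite -!(nth_map ord0 0%N val) ?size_pidx ?(ltnW lt_m) //.
by apply: (sorted_ltn_nth ltn_trans 0%N srt) => //;
  rewrite inE size_map size_pidx // ltnW.
Qed.
End CauchyBinet.

Lemma det_bound (R : numDomainType) k (A : 'M[R]_k) (r : 'I_k -> R) :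
  (forall i j, `|A i j| <= r i) -> `|\det A| <= (k`!)%:R * \prod_i r i.
Proof.
move=> Ar; rewrite /determinant; apply: le_trans (ler_norm_sum _ _ _) _.
rewrite mulr_natl -card_Sn -sumr_const [leRHS](eq_bigl predT) => [|s]; last first.
  by rewrite inE.
apply: ler_sum => s _; rewrite normrM normr_sign mul1r normr_prod.
by apply: ler_prod => i _; rewrite normr_ge0 Ar.
Qed.

(** * Limits of matrices and extraction of subsequences *)

Lemma cvg_mxP (T : topologicalType) m n (A : nat -> 'M[T]_(m, n)) (B : 'M[T]_(m, n)) :
  A @ \oo --> B <-> forall i j, (fun nu => A nu i j) @ \oo --> B i j.
Proof.
split=> [AB i j P BP|AB P [Q BQ QP]].
  apply: (AB (fun M : 'M[T]_(m, n) => P (M i j))).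
  exists (fun i' j' => if (i' == i) && (j' == j) then P else setT).
    move=> i' j'; case: ifP => [/andP[/eqP-> /eqP->] //|_]; exact: filterT.
  by move=> M /(_ i j); rewrite /= !eqxx.
suff : \forall nu \near \oo, forall i j, Q i j (A nu i j).
  by apply: filterS => nu QA; apply: QP.
apply: filter_forall => i; apply: filter_forall => j.
exact: (AB i j _ (BQ i j)).
Qed.

Lemma cvg_finsum (K : numFieldType) (I : Type) (r : seq I) (f : I -> nat -> K)
    (l : I -> K) :
  (forall i, f i @ \oo --> l i) ->
  (fun nu => \sum_(i <- r) f i nu) @ \oo --> \sum_(i <- r) l i.
Proof.
move=> fl; elim: r => [|i r IHr].
  rewrite big_nil (_ : (fun _ => _) = fun=> 0); first exact: cvg_cst.
  by apply/funext => nu; rewrite big_nil.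
rewrite big_cons (_ : (fun _ => _) = fun nu => f i nu + \sum_(i <- r) f i nu).
  by apply: cvgD => //; exact: fl.
by apply/funext => nu; rewrite big_cons.
Qed.

Lemma cvg_finprod (K : numFieldType) (I : Type) (r : seq I) (f : I -> nat -> K)
    (l : I -> K) :
  (forall i, f i @ \oo --> l i) ->
  (fun nu => \prod_(i <- r) f i nu) @ \oo --> \prod_(i <- r) l i.
Proof.
move=> fl; elim: r => [|i r IHr].
  rewrite big_nil (_ : (fun _ => _) = fun=> 1); first exact: cvg_cst.
  by apply/funext => nu; rewrite big_nil.
rewrite big_cons (_ : (fun _ => _) = fun nu => f i nu * \prod_(i <- r) f i nu).
  by apply: cvgM => //; exact: fl.
by apply/funext => nu; rewrite big_cons.
Qed.

Lemma cvg_mulmx (K : numFieldType) m n p (A : nat -> 'M[K]_(m, n))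
    (B : nat -> 'M[K]_(n, p)) (A0 : 'M[K]_(m, n)) (B0 : 'M[K]_(n, p)) :
  A @ \oo --> A0 -> B @ \oo --> B0 ->
  (fun nu => A nu *m B nu) @ \oo --> A0 *m B0.
Proof.
move=> /cvg_mxP AA /cvg_mxP BB; apply/cvg_mxP => i j; rewrite mxE.
under eq_fun do rewrite mxE.
apply: (cvg_finsum (f := fun k nu => A nu i k * B nu k j)) => k.
by apply: cvgM; [exact: AA|exact: BB].
Qed.

Lemma cvg_det (K : numFieldType) k (A : nat -> 'M[K]_k) (A0 : 'M[K]_k) :
  A @ \oo --> A0 -> (fun nu => \det (A nu)) @ \oo --> \det A0.
Proof.
move=> /cvg_mxP AA; rewrite /determinant.
apply: (cvg_finsum (f := fun (s : 'S_k) nu => (-1) ^+ s * \prod_i A nu i (s i))) => s.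
apply: cvgM; first exact: cvg_cst.
by apply: (cvg_finprod (f := fun i nu => A nu i (s i))) => i; exact: AA.
Qed.

Lemma cvg_plucker n (A : nat -> 'M[C]_(n.+1, dim2 n))
    (A0 : 'M[C]_(n.+1, dim2 n)) :
  A @ \oo --> A0 -> (fun nu => plucker (A nu)) @ \oo --> plucker A0.
Proof.
move=> /cvg_mxP AA; apply/cvg_mxP => i j; rewrite mxE.
under eq_fun do rewrite mxE.
apply: cvg_det; apply/cvg_mxP => a b; rewrite mxE.
under eq_fun do rewrite mxE.
exact: AA.
Qed.

Definition strict_incr (phi : nat -> nat) :=
  forall a b, (a < b)%N -> (phi a < phi b)%N.

Lemma strict_incr_comp phi psi :
  strict_incr phi -> strict_incr psi -> strict_incr (phi \o psi).
Proof. by move=> hphi hpsi a b ab /=; apply/hphi/hpsi. Qed.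

Lemma strict_incr_ge phi : strict_incr phi -> forall k, (k <= phi k)%N.
Proof.
by move=> hphi k; elim: k => // k IH; apply: leq_ltn_trans IH _; exact: hphi.
Qed.

Lemma strict_incr_inj phi : strict_incr phi -> injective phi.
Proof.
by move=> h a b ab; case: (ltngtP a b) => // /h; rewrite ab ltnn.
Qed.

Lemma cvg_subseq (T : topologicalType) (u : nat -> T) (l : T) phi :
  (forall k, (k <= phi k)%N) -> u @ \oo --> l -> (u \o phi) @ \oo --> l.
Proof.
move=> phi_ge ul; apply: cvg_comp ul => P [N _ NP]; exists N => // k /= Nk.
by apply: NP => /=; exact: leq_trans Nk (phi_ge k).
Qed.

(* [Q phi] speaks about the subsequence [u \o phi]; both clauses are stable under
   conjunction, so finitely many limits can be extracted at once. *)
Definition extractable (Q : (nat -> nat) -> Prop) :=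
  (forall phi psi, strict_incr psi -> Q phi -> Q (phi \o psi)) /\
  (forall phi, strict_incr phi -> exists2 psi, strict_incr psi & Q (phi \o psi)).

Lemma extractable_and Q1 Q2 : extractable Q1 -> extractable Q2 ->
  extractable (fun phi => Q1 phi /\ Q2 phi).
Proof.
move=> [s1 e1] [s2 e2]; split=> [phi psi hpsi [q1 q2]|phi hphi].
  by split; [exact: s1|exact: s2].
have [psi hpsi q1] := e1 _ hphi.
have [chi hchi q2] := e2 _ (strict_incr_comp hphi hpsi).
exists (psi \o chi); first exact: strict_incr_comp.
by split; [exact: (s1 (phi \o psi) chi)|exact: q2].
Qed.

Lemma extractable_forall (I : finType) (Q : I -> (nat -> nat) -> Prop) :
  (forall i, extractable (Q i)) -> extractable (fun phi => forall i, Q i phi).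
Proof.
move=> eQ; have : extractable (fun phi => forall i, i \in enum I -> Q i phi).
  elim: (enum I) => [|i s IHs].
    split=> [phi psi _ _|phi hphi]; first by [].
    by exists id; [move=> a b|].
  have [s1 e1] := extractable_and (eQ i) IHs; split=> [phi psi hpsi qs j|phi hphi].
    by move=> /qs; have [+ _] := eQ j; apply.
  have [psi hpsi [qi qs]] := e1 _ hphi; exists psi => // j.
  by rewrite inE => /predU1P[->|/qs].
move=> [s1 e1]; split=> [phi psi hpsi q i|phi /e1[psi hpsi q]].
  by have [+ _] := eQ i; apply.
by exists psi => // i; apply: q; rewrite mem_enum.
Qed.

Lemma extractable_sub (Q Q' : (nat -> nat) -> Prop) :
  (forall phi, Q phi <-> Q' phi) -> extractable Q -> extractable Q'.
Proof.
move=> QQ [s1 e1]; split=> [phi psi hpsi /QQ q|phi /e1[psi hpsi q]].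
  by apply/QQ/s1.
by exists psi => //; apply/QQ.
Qed.

Lemma extractable_real (u : nat -> Rdefinitions.R) : (forall k, `|u k| <= 1) ->
  extractable (fun phi => cvgn (u \o phi)).
Proof.
move=> u1; split=> [phi psi hpsi /cvg_ex[l ul]|phi hphi].
  by apply/cvg_ex; exists l; exact: (cvg_subseq (strict_incr_ge hpsi) ul).
have [|psi psi_inc cv] := @bolzano_weierstrass _ (u \o phi).
  exists 1; split=> // x x1 k _ /=; exact: le_trans (u1 _) (ltW x1).
(* [psi_inc] is an equivalence of weak inequalities; negating both sides gives strict growth. *)
exists psi => // a b; have := psi_inc b a; rewrite !leEnat => e.
by rewrite !ltnNge e.
Qed.

(** After squaring, the two sides differ by twice the product of [|Re z|] and [|Im z|]. *)
Lemma complex_le_normD (z : C) :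
  `|z| <= (`|complex.Re z| + `|complex.Im z|)%:C%C :> C.
Proof.
rewrite normc_def lecR.
rewrite -[leRHS]ger0_norm ?addr_ge0 // -[leRHS]sqrtr_sqr ler_sqrt ?sqr_ge0 // sqrrD.
by rewrite !real_normK ?num_real // addrAC lerDl mulrn_wge0 ?mulr_ge0.
Qed.

Lemma cvg_complex (u : nat -> C) (a b : Rdefinitions.R) :
  (fun nu => complex.Re (u nu)) @ \oo --> a ->
  (fun nu => complex.Im (u nu)) @ \oo --> b ->
  u @ \oo --> ((a +i* b)%C : C).
Proof.
move=> ua ub; apply/cvgrPdist_lt => e e0.
(* In the partial order of [C] a positive element has zero imaginary part, so [e] is a positive
   real. *)
have [r r0 ->] : exists2 r : Rdefinitions.R, 0 < r & e = (r%:C%C : C).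
  case: e e0 => x y; rewrite ltcE => /andP[/eqP/= y0 x0].
  by exists x => //; rewrite y0.
have r20 : 0 < r / 2 by rewrite divr_gt0.
move/cvgrPdist_lt : ua => /(_ _ r20) ua; move/cvgrPdist_lt : ub => /(_ _ r20) ub.
near=> k; apply: le_lt_trans (complex_le_normD _) _.
rewrite ltcR (splitr r); apply: ltrD.
  by rewrite raddfB /=; near: k.
by rewrite raddfB /=; near: k.
Unshelve. all: by end_near.
Qed.

Lemma extractable_cvg (u : nat -> C) : (forall k, `|u k| <= 1) ->
  extractable (fun phi => exists l : C, (u \o phi) @ \oo --> l).
Proof.
move=> u1.
have re1 k : `|complex.Re (u k)| <= 1.
  by rewrite -lecR; apply: le_trans (normc_ge_Re _) (u1 k).
have im1 k : `|complex.Im (u k)| <= 1.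
  rewrite -lecR; apply: le_trans (u1 k); rewrite normc_def lecR -sqrtr_sqr.
  by rewrite ler_sqrt ?addr_ge0 ?sqr_ge0 // lerDr sqr_ge0.
have [_ e] := extractable_and (extractable_real re1) (extractable_real im1).
split=> [phi psi hpsi [l ul]|phi /e[psi hpsi [/cvg_ex[a ua] /cvg_ex[b ub]]]].
  by exists l; exact: cvg_subseq (strict_incr_ge hpsi) ul.
by exists psi => //; exists (a +i* b)%C; exact: cvg_complex.
Qed.

Lemma extractable_mx m n (A : nat -> 'M[C]_(m, n)) :
  (forall nu i j, `|A nu i j| <= 1) ->
  extractable (fun phi => exists T : 'M[C]_(m, n), (A \o phi) @ \oo --> T).
Proof.
move=> A1; pose Q (ij : 'I_m * 'I_n) (phi : nat -> nat) :=
  exists l : C, ((fun nu => A nu ij.1 ij.2) \o phi) @ \oo --> l.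
apply: (@extractable_sub (fun phi => forall ij, Q ij phi)) => [phi|]; last first.
  by apply: extractable_forall => ij; apply: extractable_cvg => k; exact: A1.
split=> [/choice[l Al]|[T /cvg_mxP AT] ij]; last by exists (T ij.1 ij.2); exact: AT.
exists (\matrix_(i, j) l (i, j)); apply/cvg_mxP => i j; rewrite mxE.
exact: (Al (i, j)).
Qed.

(** Divide by an entry of largest modulus. *)
Lemma normalized_exists m (A : 'M[C]_m) : A != 0 ->
  exists2 c : C, c != 0 & normalized (c *: A).
Proof.
move=> A0; have [[i0 j0] A0ij] : exists ij, A ij.1 ij.2 != 0.
  apply/existsP; apply: contraNT A0; rewrite negb_exists => /forallP A0.
  apply/eqP/matrixP => i j; rewrite mxE; apply/eqP.
  by have := A0 (i, j); rewrite negbK.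
have := @real_arg_maxP C _ (i0, j0) predT (fun ij => `|A ij.1 ij.2|) isT
  (fun ij _ => normr_real _).
case=> [[i j]] /= _ Amax.
have Aij : A i j != 0.
  by rewrite -normr_gt0 (lt_le_trans _ (Amax (i0, j0) isT)) // normr_gt0.
exists (A i j)^-1; first by rewrite invr_eq0.
split=> [k l|]; last by exists i, j; rewrite mxE mulVf // normr1.
rewrite mxE normrM normfV mulrC ler_pdivrMr ?normr_gt0 // mul1r.
exact: (Amax (k, l)).
Qed.

(** Normalized representatives have entries in the closed unit disc, so compactness applies to
    them. *)
Lemma extractable_has_limit m (A : nat -> 'M[C]_m) : (forall nu, A nu != 0) ->
  extractable (fun phi => exists T, has_limit (A \o phi) T).
Proof.
move=> A0; have /choice[c cA] : forall nu, exists c, c != 0 /\ normalized (c *: A nu).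
  by move=> nu; have [c] := normalized_exists (A0 nu); exists c.
have [|_ e] := @extractable_mx _ _ (fun nu => c nu *: A nu).
  by move=> nu i j; have [_ []] := cA nu.
split=> [phi psi hpsi [T [b [b0 [bA bT]]]]|phi /e[psi hpsi [T cT]]].
  exists T, (b \o psi); split=> [nu|]; first exact: b0.
  by split=> [nu|]; [exact: bA|exact: cvg_subseq (strict_incr_ge hpsi) bT].
exists psi => //; exists T, (c \o (phi \o psi)); split=> [nu|].
  by have [] := cA (phi (psi nu)).
by split=> // nu; have [] := cA (phi (psi nu)).
Qed.

Local Open Scope sesquilinear_scope.

(** * Singular value decomposition *)

(** The order of [K] is total only among real elements, so the sorting lemmas are used relative to
    [Num.real]. *)
Lemma real_perm_sort (K : numDomainType) d (f : 'I_d -> K) :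
  (forall i, f i \is Num.real) ->
  exists p : 'S_d, forall i j : 'I_d, (i <= j)%N -> f (p j) <= f (p i).
Proof.
move=> f_real; pose t := [tuple f i | i < d].
have t_real : all (mem Num.real) t.
  by apply/allP => _ /mapP[i _ ->]; exact: f_real.
have real_total : {in mem Num.real &, total (>=%R : rel K)}.
  by move=> x y xr yr; rewrite orbC; exact: real_leVge.
have real_trans : {in mem Num.real & &, transitive (>=%R : rel K)}.
  by move=> y x z _ _ _ yx zy; exact: le_trans zy yx.
have srt := sort_sorted_in real_total t_real.
have /tuple_permP[p st] : perm_eq (sort >=%R t) t by rewrite perm_sort.
exists p => i j ij.
have nthE (k : 'I_d) : nth 0 (sort >=%R t) k = f (p k).
  by rewrite st -tnth_nth !tnth_mktuple.
have all_srt : all (mem Num.real) (sort >=%R t) by rewrite all_sort.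
rewrite -!nthE.
apply: (sorted_leq_nth_in real_trans _ _ all_srt srt) => //.
- by move=> x _; exact: lexx.
- by rewrite inE size_sort size_tuple.
- by rewrite inE size_sort size_tuple.
Qed.

Lemma unitarymx_entry_le1 (K : numClosedFieldType) d (U : 'M[K]_d) i j :
  U \is unitarymx -> `|U i j| <= 1.
Proof.
move=> /unitarymxP/matrixP/(_ i i); rewrite !mxE eqxx => /= UU.
rewrite -(@expr_le1 _ 2) // -[leRHS]UU (bigD1 j) //= !mxE -normCK lerDl.
by apply: sumr_ge0 => k _; rewrite !mxE -normCK exprn_ge0.
Qed.

(** Strict positivity confines this to invertible [A]. The right factor is [W] itself, not its
    adjoint. *)
Definition is_svd (K : numClosedFieldType) d
    (A U : 'M[K]_d) (a : 'rV[K]_d) (W : 'M[K]_d) :=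
  [/\ U \is unitarymx /\ W \is unitarymx, forall i, 0 < a 0 i,
      forall i j : 'I_d, (i <= j)%N -> a 0 j <= a 0 i &
      A = U *m diag_mx a *m W].

(** Diagonalize the product [H] of [A] with its adjoint by a unitary [P]. The rows of [P *m A] are
    then orthogonal; sorted by length and normalized, they form [W]. *)
Lemma svd_exists (K : numClosedFieldType) d (A : 'M[K]_d) : A \in unitmx ->
  exists U a W, is_svd A U a W.
Proof.
move=> Aunit; pose H := A *m A^t*.
have Hn : H \is normalmx.
  by apply/normalmxP; rewrite /H trmx_mul map_mxM trmxCK.
pose P := spectralmx H; pose sp := spectral_diag H.
have Pu : P \is unitarymx by exact: spectral_unitarymx.
have BB : (P *m A) *m (P *m A)^t* = diag_mx sp.
  have /orthomx_spectralP HE := Hn.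
  rewrite trmx_mul map_mxM mulmxA -(mulmxA P A) -/H {1}HE -/P -/sp.
  rewrite !mulmxA mulmxV ?unitarymx_unit // mul1mx -mulmxA.
  by rewrite (unitarymxP Pu) mulmx1.
have spE i : sp 0 i = \sum_j `|(P *m A) i j| ^+ 2.
  have /matrixP/(_ i i) := BB; rewrite !mxE eqxx mulr1n => <-.
  by apply: eq_bigr => j _; rewrite normCK !mxE.
(* A zero eigenvalue would give the invertible matrix [P *m A] a zero row. *)
have sp_gt0 i : 0 < sp 0 i.
  rewrite lt_def spE sumr_ge0 ?andbT => [|j _]; last exact: exprn_ge0.
  apply/eqP => /psumr_eq0P PA0; have {}PA0 j : (P *m A) i j = 0.
    apply/eqP; rewrite -normr_eq0 -sqrf_eq0; apply/eqP.
    by apply: PA0 => // k _; exact: exprn_ge0.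
  have PAu : P *m A \in unitmx by rewrite unitmx_mul unitarymx_unit.
  have /(congr1 (mulmx^~ (invmx (P *m A)))) : row i (P *m A) = 0.
    by apply/rowP => j; rewrite [LHS]mxE PA0 mxE.
  rewrite rowE mulmxK // mul0mx => /rowP/(_ i)/eqP.
  by rewrite !mxE !eqxx oner_eq0.
have [p p_sort] := real_perm_sort (fun i => gtr0_real (sp_gt0 i)).
pose Q := row_perm p P; pose b i := sqrtC (sp 0 (p i)).
have b_gt0 i : 0 < b i by rewrite sqrtC_gt0.
have Qu : Q \is unitarymx.
  apply/unitarymxP; apply/matrixP => i j.
  have /matrixP/(_ (p i) (p j)) := unitarymxP Pu.
  rewrite !mxE (inj_eq perm_inj) => <-.
  by apply: eq_bigr => k _; rewrite !mxE.
have QA : (Q *m A) *m (Q *m A)^t* = diag_mx (\row_i (b i ^+ 2)).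
  apply/matrixP => i j; have /matrixP/(_ (p i) (p j)) := BB.
  rewrite !mxE (inj_eq perm_inj) sqrtCK => <-.
  apply: eq_bigr => k _; rewrite !mxE.
  by congr (_ * _^*); apply: eq_bigr => l _; rewrite !mxE.
pose bi := \row_i (b i)^-1.
pose W := diag_mx bi *m (Q *m A).
have Wu : W \is unitarymx.
  apply/unitarymxP; rewrite /W trmx_mul map_mxM mulmxA -(mulmxA (diag_mx _)) QA.
  rewrite tr_diag_mx map_diag_mx !mulmx_diag; apply/matrixP => i j; rewrite !mxE.
  case: eqP => // _; rewrite !mulr1n.
  have /CrealP bC : (b i)^-1 \is Num.real by rewrite realV gtr0_real.
  rewrite [X in _ * X = 1](_ : _ = (b i)^-1) //.
  rewrite expr2 mulrA mulVf ?gt_eqF // mul1r.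
  by rewrite mulfV ?gt_eqF.
exists (Q ^t*), (\row_i b i), W; split.
- by rewrite trmxC_unitary.
- by move=> i; rewrite mxE.
- by move=> i j ij; rewrite !mxE ler_sqrtC ?p_sort // nnegrE ltW.
rewrite /W !mulmxA -(mulmxA (Q ^t*)) mulmx_diag.
rewrite (_ : \row_i _ = const_mx 1) ?diag_const_mx ?mulmx1.
  by rewrite -mulmxA -invmx_unitary // mulKmx // unitarymx_unit.
by apply/rowP => i; rewrite !mxE mulfV ?gt_eqF.
Qed.

(** * Limit planes from singular values *)

Lemma cvg_mx_unique m n (A : nat -> 'M[C]_(m, n)) (B B' : 'M[C]_(m, n)) :
  A @ \oo --> B -> A @ \oo --> B' -> B = B'.
Proof.
move=> /cvg_mxP AB /cvg_mxP AB'; apply/matrixP => i j.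
exact: (cvg_unique (@norm_hausdorff C C) (AB i j) (AB' i j)).
Qed.

Lemma cvg_conj_trmx m n (A : nat -> 'M[C]_(m, n)) (B : 'M[C]_(m, n)) :
  A @ \oo --> B -> (fun nu => (A nu) ^t*) @ \oo --> B ^t*.
Proof.
move=> /cvg_mxP AB; apply/cvg_mxP => i j; apply/cvgrPdist_lt => e e0.
have /cvgrPdist_lt/(_ _ e0) := AB j i; apply: filterS => nu.
by rewrite !mxE -rmorphB norm_conjC.
Qed.

Lemma cvg_unitarymx m (U : nat -> 'M[C]_m) (U0 : 'M[C]_m) :
  (forall nu, U nu \is unitarymx) -> U @ \oo --> U0 -> U0 \is unitarymx.
Proof.
move=> Uu UU0; apply/unitarymxP.
have := cvg_mulmx UU0 (cvg_conj_trmx UU0); move/cvg_mx_unique; apply.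
rewrite (_ : (fun _ => _) = fun=> 1%:M); first exact: cvg_cst.
by apply/funext => nu; apply/unitarymxP.
Qed.

Lemma cvg_dominated0 (K : C) (u v : nat -> C) :
  (forall nu, `|u nu| <= K * `|v nu|) -> v @ \oo --> (0 : C) ->
  u @ \oo --> (0 : C).
Proof.
move=> uv /cvgr0Pnorm_lt v0; apply/cvgr0Pnorm_lt => e e0.
(* [K] is an arbitrary complex number, possibly zero; [|K| + 1] is a safe divisor. *)
have K1 : 0 < `|K| + 1 by rewrite ltr_wpDl.
have := v0 (e / (`|K| + 1)) (divr_gt0 e0 K1); apply: filterS => nu.
rewrite ltr_pdivlMr // => lt_e; apply: le_lt_trans lt_e.
rewrite mulrC; apply: le_trans (ler_wpM2r (normr_ge0 _) (_ : `|K| <= _)); last first.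
  by rewrite lerDl.
rewrite -[`|v nu|]normr_id -normrM ger0_norm //.
exact: le_trans (normr_ge0 _) (uv nu).
Qed.

Lemma mulmx_bound m n p (A : 'M[C]_(m, n)) (B : 'M[C]_(n, p)) (x y : C) :
  (forall i j, `|A i j| <= x) -> (forall i j, `|B i j| <= y) ->
  forall i j, `|(A *m B) i j| <= n%:R * (x * y).
Proof.
move=> Ax By i j; rewrite mxE; apply: le_trans (ler_norm_sum _ _ _) _.
rewrite mulr_natl -[X in _ *+ X]card_ord -sumr_const; apply: ler_sum => k _.
by rewrite normrM ler_pM.
Qed.

Lemma leq_dim2 n : (n.+1 <= dim2 n)%N.
Proof. by rewrite /dim2 ltnS -addnn -addSn leq_addl. Qed.

(** The coordinates 0, ..., n, carrying the n+1 largest singular values. *)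
Definition lo n : 'I_n.+1 -> 'I_(dim2 n) := widen_ord (leq_dim2 n).

Section Compound.
Variable n : nat.

Lemma compound_bound (A : 'M[C]_(dim2 n)) (x : C) :
  (forall i j, `|A i j| <= x) ->
  forall i j, `|compound A i j| <= (n.+1`!)%:R * x ^+ n.+1.
Proof.
move=> Ax i j; rewrite mxE; apply: le_trans (det_bound (r := fun=> x) _) _.
  by move=> k l; rewrite mxE.
by rewrite prodr_const card_ord.
Qed.

(** Row [k] of a minor is bounded by the singular value at its [k]-th selected index, which is at
    least [k]. *)
Lemma compound_diag_bound (a : 'rV[C]_(dim2 n)) :
  (forall i, 0 < a 0 i) ->
  (forall i j : 'I_(dim2 n), (i <= j)%N -> a 0 j <= a 0 i) ->
  forall i j, `|compound (diag_mx a) i j| <= (n.+1`!)%:R * \prod_i a 0 (lo i).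
Proof.
move=> a0 a_sort i j; rewrite mxE; apply: (det_bound (r := fun i => a 0 (lo i))) => k l.
rewrite !mxE; apply: le_trans (_ : a 0 (sel (enum_val i) k) <= _); last first.
  by apply: a_sort; exact: leq_sel.
by case: eqP => _; rewrite ?mulr1n ?mulr0n ?normr0 ?gtr0_norm // ltW.
Qed.

Lemma compound_svd_bound : exists K : C, forall A U a W, is_svd A U a W ->
  forall i j, `|compound (A : 'M[C]_(dim2 n)) i j| <= K * \prod_i a 0 (lo i).
Proof.
pose F : C := (n.+1`!)%:R; pose N : C := #|{: pidx n}|%:R.
(* Each of the three factors contributes one [F], and each of the two products of compound matrices
   one [N]. The constant is independent of [A]. *)
exists (N * (N * (F * F) * F)) => A U a W [[Uu Wu] a0 a_sort ->] i j.
have F1 V : V \is unitarymx -> forall i j, `|compound (V : 'M[C]_(dim2 n)) i j| <= F.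
  move=> Vu k l; rewrite -[F]mulr1 -[X in F * X](expr1n _ n.+1).
  by apply: compound_bound => b c; exact: unitarymx_entry_le1.
have := mulmx_bound (mulmx_bound (F1 _ Uu) (compound_diag_bound a0 a_sort)) (F1 _ Wu).
move=> /(_ i j); rewrite -!compoundM => /le_trans; apply.
rewrite -/F -/N le_eqVlt; apply/orP; left; apply/eqP; ring.
Qed.

(* The plane [Q nu *m (U nu) ^t*] is sent by [s nu] to the plane [P *m W nu], with
   a Pluecker vector dilated by a_0 ... a_n, the order of [compound (s nu)]. *)
Lemma limit_plane_frame (G : set 'M[C]_(dim2 n)) (s U W : nat -> 'M[C]_(dim2 n))
    (a : nat -> 'rV[C]_(dim2 n)) (U0 W0 : 'M[C]_(dim2 n))
    (Q : nat -> 'M[C]_(n.+1, dim2 n)) (Q0 P : 'M[C]_(n.+1, dim2 n))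
    (Z : 'M[C]_(dim2 n, n.+1)) :
  normal_seq G s -> (forall nu, is_svd (s nu) (U nu) (a nu) (W nu)) ->
  U @ \oo --> U0 -> W @ \oo --> W0 -> Q @ \oo --> Q0 ->
  (forall nu, Q nu *m diag_mx (a nu) = diag_mx (\row_i a nu 0 (lo i)) *m P) ->
  P *m Z = 1%:M -> limit_plane G (P *m W0).
Proof.
move=> sG s_svd UU0 WW0 QQ0 QP PZ.
have W0u : W0 \is unitarymx.
  by apply: cvg_unitarymx WW0 => nu; have [[]] := s_svd nu.
have PW0 : P *m W0 *m (W0 ^t* *m Z) = 1%:M.
  by rewrite -mulmxA (mulmxA W0) (unitarymxP W0u) mul1mx.
split.
  by apply/eqP; rewrite -[_ == _]/(row_free _); apply/row_freeP; exists (W0 ^t* *m Z).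
have [_ _ _ [T sT]] := sG; exists s, T; split => //.
have [c [c0 [c_norm cT]]] := sT.
have [K s_bound] := compound_svd_bound.
pose b nu := c nu * \prod_i a nu 0 (lo i).
pose p nu := plucker (P *m W nu).
pose x := plucker (Q0 *m U0 ^t*) *m T.
(* The unitary [U nu] cancels against its adjoint, and [QP] moves the diagonal factor to the left of
   [P]. *)
have bpE nu : plucker (Q nu *m U nu ^t*) *m (c nu *: compound (s nu)) = b nu *: p nu.
  have [[Uu Wu] _ _ ->] := s_svd nu.
  rewrite -scalemxAr -plucker_mul /b -scalerA; congr (_ *: _).
  rewrite -invmx_unitary // -!mulmxA mulKmx ?unitarymx_unit // mulmxA QP -mulmxA.
  by rewrite plucker_scale_rows; congr (_ *: _); apply: eq_bigr => i _; rewrite mxE.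
have bp : (fun nu => b nu *: p nu) @ \oo --> x.
  have := cvg_mulmx (cvg_plucker (cvg_mulmx QQ0 (cvg_conj_trmx UU0))) cT.
  by apply: cvg_trans; rewrite (funext bpE).
have pp : p @ \oo --> plucker (P *m W0).
  by apply: cvg_plucker; apply: cvg_mulmx WW0; exact: cvg_cst.
have [j pj] : exists j, plucker (P *m W0) 0 j != 0.
  apply/existsP; apply: contraNT (plucker_neq0 PW0); rewrite negb_exists => /forallP p0.
  by apply/eqP/rowP => j; rewrite [RHS]mxE; apply/eqP; have := p0 j; rewrite negbK.
(* Some entry of the normalized compound matrix has modulus 1, so [s_bound] gives 1 <= K |b|: the
   factor [b nu] cannot tend to 0. *)
have pK nu i : `|p nu 0 i| <= K * `|(b nu *: p nu) 0 i|.
  have -> : (b nu *: p nu) 0 i = b nu * p nu 0 i by rewrite mxE.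
  rewrite normrM mulrA ler_peMl //.
  have [_ [k [l <-]]] := c_norm nu; 
  have -> : (c nu *: compound (s nu)) k l = c nu * compound (s nu) k l by rewrite mxE.
  rewrite !normrM.
  have := s_bound _ _ _ _ (s_svd nu) k l => /(ler_wpM2l (normr_ge0 (c nu))).
  move=> /le_trans; apply; rewrite mulrCA [`|\prod__ _|]ger0_norm //.
  by apply: prodr_ge0 => i' _; have [_ a0 _ _] := s_svd nu; exact: ltW.
move/cvg_mxP : bp => bp; move/cvg_mxP : pp => pp.
(* If [x 0 j] vanished, [pK] would force the [j]-th coordinate of [p] to tend to 0. *)
have xj : x 0 j != 0.
  apply: contraNneq pj => xj0.
  have := cvg_dominated0 (pK ^~ j); rewrite -xj0 => /(_ (bp 0 j)) pj0.
  by rewrite (cvg_unique (@norm_hausdorff C C) (pp 0 j) pj0) xj0.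
suff -> : plucker (P *m W0) = (plucker (P *m W0) 0 j / x 0 j) *: x.
  by rewrite scalemx_sub // submxMl.
(* Convergence of [b] itself is avoided by passing to the limit in the identity p_i (b p_j) = p_j (b
   p_i). *)
apply/rowP => i; rewrite [RHS]mxE mulrAC; apply: (canRL (mulfK xj)).
have lim1 := cvgM (pp 0 i) (bp 0 j); have := cvgM (pp 0 j) (bp 0 i).
rewrite (_ : _ \* _ = (fun nu => p nu 0 i) \* (fun nu => (b nu *: p nu) 0 j)).
  by move=> lim2; exact: (cvg_unique (@norm_hausdorff C C) (lim1 _) (lim2 _)).
apply/funext => nu /=.
have bE k : (b nu *: p nu) 0 k = b nu * p nu 0 k by rewrite mxE.
by rewrite !bE mulrCA [RHS]mulrCA (mulrC (p nu 0 j)).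
Qed.
End Compound.

(** * Coordinate reversal and singular values of the inverse *)

Section Reversal.
Variable m : nat.

Definition rev_mx : 'M[C]_m := perm_mx (perm rev_ord_inj).

Lemma rev_mxE i j : rev_mx i j = (rev_ord i == j)%:R.
Proof. by rewrite !mxE permE. Qed.

Lemma mulmx_rev p (A : 'M[C]_(p, m)) i j : (A *m rev_mx) i j = A i (rev_ord j).
Proof.
rewrite mxE (bigD1 (rev_ord j)) //= rev_mxE rev_ordK eqxx mulr1.
rewrite big1 ?addr0 // => k kj; rewrite rev_mxE.
by rewrite -(inj_eq rev_ord_inj) rev_ordK (negbTE kj) mulr0.
Qed.

Lemma rev_mxK : rev_mx *m rev_mx = 1%:M.
Proof.
by apply/matrixP => i j; rewrite mulmx_rev rev_mxE mxE (inj_eq rev_ord_inj).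
Qed.

Lemma rev_mx_unitary : rev_mx \is unitarymx.
Proof.
apply/unitarymxP; rewrite -[RHS]rev_mxK; congr (_ *m _).
apply/matrixP => i j; rewrite !mxE conjC_nat !permE.
by rewrite -(inj_eq rev_ord_inj) rev_ordK eq_sym.
Qed.

(** The adjoints of [W] and [U] surround the inverse diagonal, whose entries increase. Inserting
    [rev_mx] on both sides restores the decreasing order. *)
Lemma is_svd_inv (A U : 'M[C]_m) a W : is_svd A U a W ->
  is_svd (invmx A) (W ^t* *m rev_mx) (\row_j (a 0 (rev_ord j))^-1)
    (rev_mx *m U ^t*).
Proof.
move=> [[Uu Wu] a0 a_sort AE]; have Ju := rev_mx_unitary.
split.
- by split; rewrite mul_unitarymx ?trmxC_unitary.
- by move=> i; rewrite mxE invr_gt0.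
- move=> i j ij; rewrite !mxE lef_pV2 ?posrE //; apply: a_sort => /=.
  exact: leq_sub2l.
have JDJ : rev_mx *m diag_mx (\row_j (a 0 (rev_ord j))^-1) *m rev_mx =
    diag_mx (\row_j (a 0 j)^-1).
  apply/matrixP => i j; rewrite mulmx_rev mul_mx_diag !mxE permE rev_ordK.
  by rewrite (inj_eq rev_ord_inj) mulr_natl; case: eqP => [->|].
have -> : W ^t* *m rev_mx *m diag_mx (\row_j (a 0 (rev_ord j))^-1) *m
    (rev_mx *m U ^t*) = W ^t* *m diag_mx (\row_j (a 0 j)^-1) *m U ^t*.
  by rewrite -JDJ !mulmxA.
rewrite -!invmx_unitary //; set B := _ *m invmx U.
have AB : A *m B = 1%:M.
  rewrite AE /B -!mulmxA (mulKVmx (unitarymx_unit Wu)) (mulmxA (diag_mx a)).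
  rewrite mulmx_diag (_ : \row_i _ = const_mx 1) ?diag_const_mx ?mul1mx.
    by rewrite mulmxV ?unitarymx_unit.
  by apply/rowP => i; rewrite !mxE mulfV ?gt_eqF.
have [Au _] := mulmx1_unit AB.
by rewrite -[RHS](mulKmx Au) AB mulmx1.
Qed.
End Reversal.

(** * Planes spanned by leading coordinate vectors *)

Section Frame.
Variable n : nat.
Notation d := (dim2 n).

Lemma mid_subproof : (n.+1 < d)%N.
Proof. by rewrite /dim2 !ltnS -addnn leq_addr. Qed.

Definition mid : 'I_d := Ordinal mid_subproof.

(* The planes through e_0, ..., e_{n-1} inside <e_0, ..., e_{n+1}>. *)
Definition frame (x y : C) : 'M[C]_(n.+1, d) :=
  \matrix_(i, j) if i == ord_max then x *+ (j == lo ord_max) + y *+ (j == mid)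
                 else (j == lo i)%:R.

Lemma lo_inj : injective (@lo n).
Proof. by move=> i j /(congr1 val) /= /val_inj. Qed.

Lemma mid_neq_lo i : (mid == lo i) = false.
Proof. by apply/negbTE; rewrite -val_eqE /= gtn_eqF. Qed.

Lemma lo_neq_mid i : (lo i == mid) = false.
Proof. by rewrite eq_sym mid_neq_lo. Qed.

Lemma index_cases (j : 'I_d) : [\/ exists i, j = lo i, j = mid | (n.+1 < j)%N].
Proof.
have [lt_j|] := ltnP j n.+1.
  by apply: Or31; exists (Ordinal lt_j); apply: val_inj.
rewrite leq_eqVlt => /predU1P[nj|]; last by apply: Or33.
by apply: Or32; apply: val_inj.
Qed.

(** The transpose is taken without conjugation, so the last rows pair to [x * z + y * t]. The right
    inverse certifies full rank and feeds [limit_plane_frame]. *)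
Lemma frame_right_inverse x y z t : x * z + y * t = 1 ->
  frame x y *m (frame z t)^T = 1%:M.
Proof.
move=> xzyt; apply/matrixP => i j; rewrite !mxE.
have E0 (l : 'I_d) : (frame z t)^T l j =
    if j == ord_max then z *+ (l == lo ord_max) + t *+ (l == mid)
    else (l == lo j)%:R by rewrite !mxE.
have [->|ni] := eqVneq i ord_max.
  rewrite (bigD1 (lo ord_max)) // (bigD1 mid) ?mid_neq_lo //=.
  rewrite big1 => [|l /andP[/negbTE l1 /negbTE l2]]; last first.
    by rewrite mxE eqxx l1 l2 !mulr0n addr0 mul0r.
  rewrite !E0 !mxE !eqxx !mid_neq_lo !lo_neq_mid addr0.
  rewrite !mulr0n !mulr1n add0r addr0 (inj_eq lo_inj) eq_sym.
  by case: eqP => _; rewrite ?addr0 ?add0r ?mulr0 ?addr0.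
rewrite (bigD1 (lo i)) //= big1 => [|l /negbTE l1]; last first.
  by rewrite mxE (negbTE ni) l1 mul0r.
rewrite E0 !mxE (negbTE ni) eqxx mul1r addr0 !(inj_eq lo_inj) (negbTE ni) lo_neq_mid.
by case: eqP => [->|_ //]; rewrite (negbTE ni) addr0.
Qed.

(** Only the last row matters: (x a_n, y' a_{n+1}) = a_n (x, y). Thus [y'] is the parameter of the
    source plane and [y] that of its image. *)
Lemma frame_diag x y y' (a : 'rV[C]_d) : y' * a 0 mid = a 0 (lo ord_max) * y ->
  frame x y' *m diag_mx a = diag_mx (\row_i a 0 (lo i)) *m frame x y.
Proof.
move=> yy; apply/matrixP => i j; rewrite mul_mx_diag mul_diag_mx !mxE.
have [->|_] := eqVneq i ord_max; last first.
  by case: eqP => [->|_]; rewrite ?mulr1 ?mul1r ?mulr0 ?mul0r.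
case: (index_cases j) => [[l ->]|->|lt_j].
- rewrite lo_neq_mid !addr0; case: eqP => [->|_]; first by rewrite mulrC.
  by rewrite !mulr0n mulr0 mul0r.
- by rewrite eqxx mid_neq_lo !mulr0n !add0r !mulr1n.
have -> : (j == mid) = false by rewrite -val_eqE /= gtn_eqF.
have -> : (j == lo ord_max) = false by rewrite -val_eqE /= gtn_eqF // ltnW.
by rewrite addr0 !mulr0n mulr0 mul0r.
Qed.

Lemma mul_frame (z : 'rV[C]_n.+1) x y j : (z *m frame x y) 0 j =
  if j == mid then z 0 ord_max * y else
  \sum_i (if i == ord_max then z 0 i * x else z 0 i) *+ (j == lo i).
Proof.
rewrite mxE; have [->|nj] := eqVneq j mid.
  rewrite (bigD1 ord_max) //= mxE eqxx mid_neq_lo mulr0n add0r eqxx mulr1n.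
  by rewrite big1 ?addr0 // => i /negbTE ni; rewrite mxE ni mid_neq_lo mulr0.
apply: eq_bigr => i _; rewrite mxE (negbTE nj) addr0.
case: eqP => [->|_]; first by rewrite mulrnAr.
by rewrite mulr_natr.
Qed.

Lemma sub_frame (v : 'rV[C]_d) x y (z : C) :
  v 0 (lo ord_max) = z * x -> v 0 mid = z * y ->
  (forall j : 'I_d, (n.+1 < j)%N -> v 0 j = 0) -> (v <= frame x y)%MS.
Proof.
move=> vx vy v0; apply/submxP.
exists (\row_i (if i == ord_max then z else v 0 (lo i))).
apply/rowP => j; rewrite mul_frame.
case: (index_cases j) => [[l ->]|->|lt_j].
- rewrite lo_neq_mid (bigD1 l) //= eqxx big1 => [|i /negbTE il]; last first.
    by rewrite (inj_eq lo_inj) [l == i]eq_sym il.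
  by rewrite addr0 mxE; case: eqP => // ->.
- by rewrite eqxx mxE eqxx.
have -> : (j == mid) = false by rewrite -val_eqE /= gtn_eqF.
rewrite v0 // big1 // => i _.
have -> // : (j == lo i) = false.
by rewrite -val_eqE /= gtn_eqF // (ltn_trans (ltn_ord i)).
Qed.

Lemma sub_frame10 (v : 'rV[C]_d) :
  (forall j : 'I_d, (n < j)%N -> v 0 j = 0) -> (v <= frame 1 0)%MS.
Proof.
move=> v0; apply: (@sub_frame _ _ _ (v 0 (lo ord_max))).
- by rewrite mulr1.
- by rewrite mulr0 v0.
by move=> j lt_j; apply: v0; exact: ltnW.
Qed.

Lemma cvg_frame (x : C) (y : nat -> C) (y0 : C) : y @ \oo --> y0 ->
  (fun nu => frame x (y nu)) @ \oo --> frame x y0.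
Proof.
move=> yy; apply/cvg_mxP => i j.
rewrite (_ : (fun _ => _) = fun nu => if i == ord_max
   then x *+ (j == lo ord_max) + y nu *+ (j == mid) else (j == lo i)%:R); last first.
  by apply/funext => nu; rewrite mxE.
rewrite mxE; case: eqP => _; last exact: cvg_cst.
apply: cvgD; first exact: cvg_cst.
by case: eqP => _; [exact: yy|exact: cvg_cst].
Qed.

(** Dimension count: the vanishing of the last n coordinates imposes n linear conditions on a space
    of dimension n+1. *)
Lemma nplane_meets (B : 'M[C]_(n.+1, d)) (W : 'M[C]_d) : nplane B -> W \in unitmx ->
  exists v : 'rV[C]_d, [/\ v != 0, (v <= B)%MS &
    forall j : 'I_d, (n.+1 < j)%N -> (v *m invmx W) 0 j = 0].
Proof.
move=> Bn Wu; have lt_hi (j : 'I_n) : (n.+2 + j < d)%N.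
  by rewrite /dim2 !addSn !ltnS -addnn ltn_add2l.
pose Y := colsub (fun j => Ordinal (lt_hi j)) (B *m invmx W).
have : kermx Y != 0.
  rewrite -mxrank_eq0 mxrank_ker subn_eq0 -ltnNge ltnS.
  exact: rank_leq_col.
move=> /rowV0Pn[u /sub_kermxP uY u0]; exists (u *m B); split.
- rewrite mulmx_free_eq0 // /row_free; exact/eqP.
- exact: submxMl.
move=> j lt_j; have lt_jn : (j - n.+2 < n)%N.
  by rewrite ltn_subLR // !addSn addnn.
have /rowP/(_ (Ordinal lt_jn)) := uY.
rewrite /Y mulmx_colsub mulmxA !mxE => {2}<-.
apply: eq_bigr => k _; congr (_ * invmx W _ _).
by apply: val_inj; rewrite /= subnKC.
Qed.
End Frame.

(** * Contraction towards the attracting plane *)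

Lemma open_rVP m (S : set 'rV[C]_m) :
  (forall v, S v -> exists2 e : C, 0 < e &
    forall w : 'rV[C]_m, (forall j, `|v 0 j - w 0 j| < e) -> S w) -> open S.
Proof.
move=> H; rewrite openE => v /H[e e0 He].
apply/nbhs_ballP; exists e => //= w [_ vw]; apply: He => j.
exact: vw.
Qed.

(** Its homogeneity makes an inequality between [norm1 v] and a coordinate of [v *m U] a condition
    on the projective point. *)
Definition norm1 m (v : 'rV[C]_m) : C := \sum_j `|v 0 j|.

Lemma norm1_ge0 m (v : 'rV[C]_m) : 0 <= norm1 v.
Proof. exact: sumr_ge0. Qed.

Lemma norm1_gt0 m (v : 'rV[C]_m) : v != 0 -> 0 < norm1 v.
Proof.
move=> v0; rewrite lt_def norm1_ge0 andbT; apply: contra v0 => /eqP v0.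
apply/eqP/rowP => j; apply/eqP; rewrite mxE -normr_eq0.
by have /psumr_eq0P -> := v0.
Qed.

Lemma norm1Z m c (v : 'rV[C]_m) : norm1 (c *: v) = `|c| * norm1 v.
Proof. by rewrite mulr_sumr; apply: eq_bigr => j _; rewrite mxE normrM. Qed.

Lemma norm1D m (v w : 'rV[C]_m) : norm1 (v + w) <= norm1 v + norm1 w.
Proof. by rewrite -big_split; apply: ler_sum => j _; rewrite mxE ler_normD. Qed.

Lemma norm_mulmx m p (v : 'rV[C]_m) (A : 'M[C]_(m, p)) e j :
  (forall i j, `|A i j| <= e) -> `|(v *m A) 0 j| <= norm1 v * e.
Proof.
move=> Ae; rewrite mxE mulr_suml; apply: le_trans (ler_norm_sum _ _ _) _.
by apply: ler_sum => i _; rewrite normrM ler_wpM2l.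
Qed.

(** The sets [O K] form a projectively open cover of [M], and a finite subcover gives a uniform
    constant. *)
Lemma pcompact_norm_bound n (M : set 'rV[C]_(dim2 n)) (U : 'M[C]_(dim2 n)) :
  U \is unitarymx -> pcompact M ->
  (forall v, M v -> exists i : 'I_n.+1, (v *m U) 0 (lo i) != 0) ->
  exists2 K : C, 0 < K &
    forall v, M v -> exists i : 'I_n.+1, norm1 v < K * `|(v *m U) 0 (lo i)|.
Proof.
move=> Uu [Msat Mc] MU.
pose O (K : C) := [set v : 'rV[C]_(dim2 n) | 0 < K /\
  exists i : 'I_n.+1, norm1 v < K * `|(v *m U) 0 (lo i)|].
have U1 i j : `|U i j| <= 1 by exact: unitarymx_entry_le1.
have O_open K : popen (O K).
  split.
    move=> v [K0 [i lt_i]]; split.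
      apply: contraTneq lt_i => ->; rewrite mul0mx mxE normr0 mulr0.
      by rewrite le_gtF ?norm1_ge0.
    move=> c c0; split=> //; exists i.
    by rewrite -scalemxAl norm1Z mxE normrM mulrCA ltr_pM2l ?normr_gt0.
  apply: open_rVP => v [K0 [i lt_i]].
  pose g := K * `|(v *m U) 0 (lo i)| - norm1 v.
  have g0 : 0 < g by rewrite subr_gt0.
  have K1 : 0 < K + 1 by rewrite addr_gt0.
  (* Moving [v] to [w] costs [norm1 (v - w)] on the left and [K] times as much on the right, whence
     [K + 1]; the dimension turns an entrywise bound into one for [norm1]. *)
  pose e := g / ((K + 1) * (dim2 n)%:R).
  have d0 : 0 < (dim2 n)%:R :> C by rewrite ltr0n.
  exists e; first by rewrite divr_gt0 ?mulr_gt0.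
  move=> w vw; split=> //; exists i.
  have vw1 : norm1 (v - w) < g / (K + 1).
    have -> : g / (K + 1) = \sum_(j < dim2 n) e.
      rewrite sumr_const card_ord -mulr_natr /e invfM mulrA mulfVK //.
      by rewrite gt_eqF.
    rewrite /norm1 (bigD1 ord0) //= [ltRHS](bigD1 ord0) //=.
    apply: ltr_leD; first by rewrite !mxE vw.
    by apply: ler_sum => j _; rewrite !mxE ltW.
  have hw : norm1 w <= norm1 v + norm1 (v - w).
    rewrite -[X in norm1 X <= _](subKr v) (le_trans (norm1D _ _)) // lerD2l.
    by rewrite /norm1; under eq_bigr do rewrite mxE normrN.
  have hF : `|(v *m U) 0 (lo i)| <= `|(w *m U) 0 (lo i)| + norm1 (v - w).
    rewrite -lerBlDl (le_trans (lerB_dist _ _)) //.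
    rewrite -[leRHS]mulr1 (le_trans _ (norm_mulmx _ (lo i) U1)) //.
    by rewrite mulmxBl !mxE.
  move: vw1; rewrite ltr_pdivlMr // mulrDr mulr1 => vw1.
  apply: le_lt_trans hw _.
  rewrite -(ltrD2r (norm1 (v - w) * K)).
  have -> : K * `|(w *m U) 0 (lo i)| + norm1 (v - w) * K =
      K * (`|(w *m U) 0 (lo i)| + norm1 (v - w)) by ring.
  apply: lt_le_trans (ler_wpM2l (ltW K0) hF).
  by rewrite -addrA addrC -ltrBrDr addrC.
have MO : M `<=` \bigcup_K O K.
  move=> v Mv; have [i vi] := MU v Mv; have [v0 _] := Msat v Mv.
  have F0 : 0 < `|(v *m U) 0 (lo i)| by rewrite normr_gt0.
  exists ((norm1 v + 1) / `|(v *m U) 0 (lo i)|) => //.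
  have N0 : 0 < norm1 v + 1 by rewrite addr_gt0 ?norm1_gt0.
  split; first by rewrite divr_gt0.
  by exists i; rewrite divfK ?gt_eqF // ltrDl.
have [F [/finite_seqP[s ->] MF]] := Mc _ O O_open MO.
(* This dominates every positive [K] of the subcover; the 1 keeps it positive if [s] is empty. *)
exists (1 + \sum_(K <- s) `|K|).
  by rewrite ltr_pwDl // sumr_ge0.
move=> v /MF[K /= Ks [K0 [i lt_i]]]; exists i; apply: lt_le_trans lt_i _.
rewrite ler_wpM2r // (big_rem K) //= (gtr0_norm K0) addrCA lerDl.
by rewrite addr_ge0 // sumr_ge0.
Qed.

Section Convergence.
Variable n : nat.
Notation d := (dim2 n).

(** By contradiction: points of [M] with images outside [V] at arbitrarily late indices would, after
    rescaling, have images accumulating on the plane. *)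
Lemma svd_converges (s U W : nat -> 'M[C]_d) (a : nat -> 'rV[C]_d) (U0 W0 : 'M[C]_d)
    (M V : set 'rV[C]_d) :
  (forall nu, is_svd (s nu) (U nu) (a nu) (W nu)) ->
  U @ \oo --> U0 -> W @ \oo --> W0 ->
  (fun nu => a nu 0 (mid n) / a nu 0 (lo ord_max)) @ \oo --> (0 : C) ->
  pcompact M ->
  (forall v, M v -> exists i : 'I_n.+1, (v *m U0) 0 (lo i) != 0) ->
  pnbhd V (pts (frame n 1 0 *m W0)) ->
  exists m0 : nat, forall nu, (m0 < nu)%N -> forall v, M v -> V (v *m s nu).
Proof.
move=> s_svd UU0 WW0 r0 Mc MU [Vsat [S [[Ssat So] BS SV]]].
have U0u : U0 \is unitarymx.
  by apply: cvg_unitarymx UU0 => nu; have [[]] := s_svd nu.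
have W0u : W0 \is unitarymx.
  by apply: cvg_unitarymx WW0 => nu; have [[]] := s_svd nu.
have [K K0 MK] := pcompact_norm_bound U0u Mc MU.
pose r nu := a nu 0 (mid n) / a nu 0 (lo ord_max).
(* This threshold serves twice: [U nu] may replace [U0] at the cost of a factor 2 in [MK], and
   [2 * K * r nu] stays below 1. *)
have K20 : 0 < (2 * K)^-1 by rewrite invr_gt0 mulr_gt0.
have near_r : \forall nu \near \oo, r nu < (2 * K)^-1.
  move/cvgr0Pnorm_lt : r0 => /(_ _ K20); apply: filterS => nu.
  by rewrite gtr0_norm //; have [_ a0 _ _] := s_svd nu; rewrite divr_gt0.
have near_U : \forall nu \near \oo, forall i j, `|U0 i j - U nu i j| < (2 * K)^-1.
  move/cvg_mxP : UU0 => UU0.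
  apply: filter_forall => i; apply: filter_forall => j.
  by move/cvgrPdist_lt : (UU0 i j) => /(_ _ K20).
have near_good := filterI near_r near_U.
have [m1 _ good] := near_good.
apply: contrapT => no_m0.
(* Indices beyond [m] tend to infinity; those from [m1] on satisfy the estimates of [good]. *)
have /choice[t tP] : forall m : nat, exists t : nat * 'rV[C]_d,
    [/\ (m < t.1)%N, (m1 <= t.1)%N, M t.2 & ~ V (t.2 *m s t.1)].
  move=> m; apply: contrapT => no_t; apply: no_m0; exists (maxn m m1) => nu.
  rewrite gtn_max => /andP[m_lt m1_lt] v Mv; apply: contrapT => nV.
  by apply: no_t; exists (nu, v); split=> //=; exact: ltnW.
pose nu m := (t m).1; pose v m := (t m).2.
pose y m := v m *m U (nu m) *m diag_mx (a (nu m)).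
pose N m := \sum_(i < n.+1) `|y m 0 (lo i)|.
have yE m j : y m 0 j = (v m *m U (nu m)) 0 j * a (nu m) 0 j.
  by rewrite /y mul_mx_diag mxE.
have key m : 0 < N m /\ forall j : 'I_d, (n < j)%N ->
    `|y m 0 j| <= 2 * K * r (nu m) * N m.
  have [m_lt m1_le Mv _] := tP m; have [r_lt U_lt] := good _ m1_le.
  have [[Uu Wu] a0 a_sort _] := s_svd (nu m).
  have [v0 _] := Mc.1 _ Mv; have nv0 := norm1_gt0 v0.
  have [i lt_i] := MK _ Mv.
  (* U0 - U_nu costs at most half of the lower bound given by [MK] *)
  have vU : norm1 (v m) <= 2 * K * `|(v m *m U (nu m)) 0 (lo i)|.
    have dU : `|(v m *m U0) 0 (lo i)| <=
        `|(v m *m U (nu m)) 0 (lo i)| + norm1 (v m) / (2 * K).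
      rewrite -lerBlDl (le_trans (lerB_dist _ _)) //.
      rewrite (le_trans _ (norm_mulmx (A := U0 - U (nu m)) (v m) (lo i) _)) //.
        by rewrite mulmxBr !mxE.
      by move=> k l; rewrite !mxE; apply: ltW; exact: U_lt.
    have := le_trans (ltW lt_i) (ler_wpM2l (ltW K0) dU).
    have -> : K * (`|(v m *m U (nu m)) 0 (lo i)| + norm1 (v m) / (2 * K)) =
        K * `|(v m *m U (nu m)) 0 (lo i)| + norm1 (v m) / 2.
      by field; rewrite gt_eqF.
    rewrite -lerBlDr; have -> : norm1 (v m) - norm1 (v m) / 2 = norm1 (v m) / 2.
      by field.
    by rewrite ler_pdivrMr // mulrC mulrA.
  (* The coordinate [i] carries a singular value at least a_n, so it makes [N m] large. *)
  have an : norm1 (v m) * a (nu m) 0 (lo ord_max) <= 2 * K * N m.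
    apply: le_trans (ler_wpM2r (ltW (a0 _)) vU) _.
    rewrite -[leLHS]mulrA ler_pM2l ?mulr_gt0 //.
    apply: (@le_trans _ _ `|y m 0 (lo i)|).
      rewrite yE normrM (gtr0_norm (a0 _)) ler_wpM2l // a_sort //=.
      exact: leq_ord.
    by rewrite /N (bigD1 i) //= lerDl sumr_ge0.
  have N0 : 0 < N m.
    have : 0 < 2 * K * N m by apply: lt_le_trans an; rewrite mulr_gt0.
    by rewrite pmulr_rgt0 // mulr_gt0.
  split=> // j lt_j.
  have aj : a (nu m) 0 j <= r (nu m) * a (nu m) 0 (lo ord_max).
    by rewrite /r divfK ?gt_eqF ?a_sort.
  have : `|y m 0 j| <= norm1 (v m) * (r (nu m) * a (nu m) 0 (lo ord_max)).
    rewrite yE normrM (gtr0_norm (a0 j)); apply: ler_pM => //; first exact: ltW.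
    rewrite -[leRHS]mulr1; apply: norm_mulmx => k l; exact: unitarymx_entry_le1.
  move=> /le_trans; apply; rewrite mulrCA [leRHS]mulrAC.
  by rewrite [leRHS]mulrC ler_wpM2l // /r divr_ge0 // ltW.
(* The leading coordinates now have total modulus 1, which keeps the limit nonzero, while the others
   are controlled by [r]. *)
pose x m := (N m)^-1 *: y m.
have r_gt0 m : 0 < r (nu m) by have [_ a0 _ _] := s_svd (nu m); rewrite divr_gt0.
have xhi m (j : 'I_d) : (n < j)%N -> `|x m 0 j| <= 2 * K * `|r (nu m)|.
  have [N0 yhi] := key m; move=> /yhi.
  have -> : x m 0 j = (N m)^-1 * y m 0 j by rewrite mxE.
  rewrite normrM normfV (gtr0_norm N0) (gtr0_norm (r_gt0 m)) => y_le.
  by rewrite mulrC ler_pdivrMr.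
have x1 m i j : `|x m i j| <= 1.
  rewrite ord1; have [N0 _] := key m; have [m_lt m1_le _ _] := tP m.
  have [r_lt _] := good _ m1_le.
  have [lt_j|] := ltnP n j.
    apply: le_trans (xhi _ _ lt_j) _; rewrite gtr0_norm //.
    rewrite mulrC -ler_pdivlMr ?mulr_gt0 // mul1r; exact: ltW.
  rewrite -ltnS => lt_j; have -> : j = lo (Ordinal lt_j) by exact: val_inj.
  rewrite mxE normrM normfV (gtr0_norm N0) mulrC ler_pdivrMr // mul1r.
  by rewrite /N (bigD1 (Ordinal lt_j)) //= lerDl sumr_ge0.
have [psi hpsi [x0 xx0]] := (extractable_mx x1).2 id (fun a b => id).
have nu_ge k : (k <= (nu \o psi) k)%N.
  apply: leq_trans (strict_incr_ge hpsi k) _.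
  by have [lt_k _ _ _] := tP (psi k); exact: ltnW.
have rr : (fun m => r (nu (psi m))) @ \oo --> (0 : C).
  exact: (cvg_subseq nu_ge r0).
move/cvg_mxP : (xx0) => xx0e.
have x0hi (j : 'I_d) : (n < j)%N -> x0 0 j = 0.
  move=> lt_j; have := cvg_dominated0 (fun m => xhi (psi m) j lt_j) rr.
  exact: (cvg_unique (@norm_hausdorff C C) (xx0e 0 j)).
have x0_neq0 : x0 != 0.
  apply/eqP => x00.
  have xs : (fun m => \sum_(i < n.+1) `|x (psi m) 0 (lo i)|) @ \oo -->
      \sum_(i < n.+1) `|x0 0 (lo i)|.
    apply: (cvg_finsum (f := fun i m => `|x (psi m) 0 (lo i)|)) => i.
    by apply: cvg_norm; exact: xx0e.
  have xs1 : (fun m => \sum_(i < n.+1) `|x (psi m) 0 (lo i)|) = fun=> 1.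
    apply/funext => m; have [N0 _] := key (psi m).
    under eq_bigr do rewrite mxE normrM normfV (gtr0_norm N0).
    by rewrite -mulr_sumr mulVf // gt_eqF.
  rewrite xs1 in xs.
  have s1 : 1 = \sum_(i < n.+1) `|x0 0 (lo i)| :> C.
    by apply: (cvg_unique (@norm_hausdorff C C) _ xs); exact: cvg_cst.
  move/eqP : s1; rewrite big1 ?oner_eq0 // => i _.
  by rewrite x00 mxE normr0.
have Sx0 : S (x0 *m W0).
  apply: BS; split.
    apply: contra x0_neq0 => /eqP xW.
    by rewrite -(mulmxK (unitarymx_unit W0u) x0) xW mul0mx.
  by apply: submxMr; exact: sub_frame10.
have xW := cvg_mulmx xx0 (cvg_subseq nu_ge WW0).
(* One late index suffices: its image differs from a point of [V] by the positive scalar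
   [N (psi m2)], and [V] is saturated. *)
have [m2 _ /(_ m2 (leqnn _)) /SV Vx] := xW _ (open_nbhs_nbhs (conj So Sx0)).
have [_ _ _] := tP (psi m2); apply.
have [N0 _] := key (psi m2); have [_ _ _ ->] := s_svd (nu (psi m2)).
have [_ /(_ (N (psi m2)))] := Vsat _ Vx; rewrite gt_eqF // => /(_ isT).
by rewrite /= scalemxAl /x scalerA mulfV ?gt_eqF // scale1r /y !mulmxA.
Qed.
End Convergence.

(** * Vanishing of the middle ratio and conclusion *)

Lemma unitmx_neq0 m (A : 'M[C]_m.+1) : A \in unitmx -> A != 0.
Proof. by rewrite unitmxE; apply: contraTneq => ->; rewrite det0 unitr0. Qed.

(** It maps the Pluecker vector of a frame to that of another plane, which is nonzero. *)
Lemma compound_neq0 n (A : 'M[C]_(dim2 n)) : A \in unitmx -> compound A != 0.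
Proof.
move=> Au; have f1 : frame n 1 0 *m (frame n 1 0)^T = 1%:M.
  by apply: frame_right_inverse; rewrite mulr1 mulr0 addr0.
have : plucker (frame n 1 0 *m A) != 0.
  apply: (plucker_neq0 (Z := invmx A *m (frame n 1 0)^T)).
  by rewrite mulmxA mulmxK.
by rewrite plucker_mul; apply: contraNneq => ->; rewrite mulmx0.
Qed.

Lemma proj_eq_invmx m (A B : 'M[C]_m) : A \in unitmx ->
  proj_eq (invmx A) (invmx B) -> proj_eq A B.
Proof.
move=> Au [c [c0 AB]]; exists c^-1; split; first by rewrite invr_eq0.
by rewrite -(invmxK A) AB invmxZ ?invmxK // -AB unitmx_inv.
Qed.

(** If [r0] were nonzero, the point [v] where [B] meets the exceptional subspace would lie on a
    limit plane, although [B] lies in [Omega G]. *)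
Lemma middle_ratio_cvg0 n (G : set 'M[C]_(dim2 n)) (s U W : nat -> 'M[C]_(dim2 n))
    (a : nat -> 'rV[C]_(dim2 n)) (U0 W0 : 'M[C]_(dim2 n)) (r0 : C)
    (B : 'M[C]_(n.+1, dim2 n)) :
  normal_seq G s -> (forall nu, is_svd (s nu) (U nu) (a nu) (W nu)) ->
  U @ \oo --> U0 -> W @ \oo --> W0 ->
  (fun nu => a nu 0 (mid n) / a nu 0 (lo ord_max)) @ \oo --> r0 ->
  nplane B -> pts B `<=` Omega G -> r0 = 0.
Proof.
move=> sG s_svd UU0 WW0 rr0 Bn BG; apply: contrapT => /eqP r0_neq0.
have W0u : W0 \is unitarymx.
  by apply: cvg_unitarymx WW0 => nu; have [[]] := s_svd nu.
have [v [v0 vB v_hi]] := nplane_meets Bn (unitarymx_unit W0u).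
have [_ []] := BG v (conj v0 vB).
set y := v *m invmx W0 in v_hi.
(* (p, q) is the direction of the coordinates n and n+1 of [y], and (z, t) certifies that it is
   nonzero. When both coordinates vanish, (1, 0) serves with [c = 0]. *)
have [p [q [z [t [c [cp cq pzqt]]]]]] : exists p q z t c : C,
    [/\ y 0 (lo ord_max) = c * p, y 0 (mid n) = c * q & p * z + q * t = 1].
  have [x0|x0] := eqVneq (y 0 (lo ord_max)) 0; last first.
    exists (y 0 (lo ord_max)), (y 0 (mid n)), (y 0 (lo ord_max))^-1, 0, 1.
    by rewrite !mul1r mulfV // mulr0 addr0.
  have [x1|x1] := eqVneq (y 0 (mid n)) 0; last first.
    exists (y 0 (lo ord_max)), (y 0 (mid n)), 0, (y 0 (mid n))^-1, 1.
    by rewrite !mul1r mulfV // mulr0 add0r.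
  by exists 1, 0, 1, 0, 0; rewrite x0 x1 !mul0r mulr1 addr0.
have yP : (y <= frame n p q)%MS by exact: sub_frame cp cq v_hi.
exists (frame n p q *m W0); split; last first.
  by split=> //; rewrite -(mulmxKV (unitarymx_unit W0u) v) submxMr.
pose r nu := a nu 0 (mid n) / a nu 0 (lo ord_max).
(* The source parameter [q / r nu] is the one required by [frame_diag]; it converges because [r0] is
   nonzero. *)
have QQ0 : (fun nu => frame n p (q / r nu)) @ \oo --> frame n p (q / r0).
  by apply: cvg_frame; apply: cvgM; [exact: cvg_cst|exact: cvgV].
apply: (limit_plane_frame sG s_svd UU0 WW0 QQ0 _ (frame_right_inverse n pzqt)).
move=> nu; apply: frame_diag; have [_ a0 _ _] := s_svd nu.
by rewrite /r invf_div -!mulrA mulVf ?gt_eqF // mulr1 mulrC.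
Qed.

Unset Implicit Arguments.

Theorem theorem4p8 (n : nat) (G : set 'M[C]_(dim2 n))
    (s : nat -> 'M[C]_(dim2 n)) :
  (0 < n)%N ->
  typeL G ->
  (forall nu, G (s nu)) ->
  (forall nu mu, nu <> mu -> ~ proj_eq (s nu) (s mu)) ->
  exists (BI BK : 'M[C]_(n.+1, dim2 n)) (phi : nat -> nat),
    [/\ limit_plane G BI, limit_plane G BK,
        (forall a b, (a < b)%N -> (phi a < phi b)%N) &
        forall M V : set 'rV[C]_(dim2 n),
          pcompact M -> M `&` pts BK = set0 -> pnbhd V (pts BI) ->
          exists m0 : nat, forall nu, (m0 < nu)%N ->
            forall v, M v -> V (v *m s (phi nu))].
Proof.
move=> _ [[Gu _ _ _ Ginv] _ [D [[_ _ [B [Bn BD]]] DG]]] sG s_neq.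
have su nu : s nu \in unitmx by exact: Gu.
have /choice[t tP] : forall nu,
    exists t : 'M[C]_(dim2 n) * 'rV[C]_(dim2 n) * 'M[C]_(dim2 n),
    is_svd (s nu) t.1.1 t.1.2 t.2.
  by move=> nu; have [U [a [W]]] := svd_exists (su nu); exists (U, a, W).
pose U nu := (t nu).1.1; pose a nu := (t nu).1.2; pose W nu := (t nu).2.
have s_svd nu : is_svd (s nu) (U nu) (a nu) (W nu) by exact: tP.
pose r nu := a nu 0 (mid n) / a nu 0 (lo ord_max).
have U1 nu i j : `|U nu i j| <= 1.
  by apply: unitarymx_entry_le1; have [[]] := s_svd nu.
have W1 nu i j : `|W nu i j| <= 1.
  by apply: unitarymx_entry_le1; have [[]] := s_svd nu.
have r1 nu : `|r nu| <= 1.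
  have [_ a0 a_sort _] := s_svd nu.
  by rewrite gtr0_norm ?divr_gt0 // ler_pdivrMr // mul1r a_sort //=.
have siu nu : invmx (s nu) \in unitmx by rewrite unitmx_inv.
have E1 := extractable_and (extractable_mx U1) (extractable_mx W1).
have E2 := extractable_and E1 (extractable_cvg r1).
have E3 := extractable_and E2 (extractable_has_limit (fun nu => unitmx_neq0 (su nu))).
have E4 := extractable_and E3
  (extractable_has_limit (fun nu => compound_neq0 (su nu))).
(* The inverse sequence must become normal as well, since it is what exhibits [BK] as a limit
   plane. *)
have E5 := extractable_and E4
  (extractable_has_limit (fun nu => unitmx_neq0 (siu nu))).
have [_ E6] := extractable_and E5
  (extractable_has_limit (fun nu => compound_neq0 (siu nu))).
have [phi hphi] := E6 id (fun a b => id).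
case=> [[[[[[[U0 UU0] [W0 WW0]] [r0 rr0]] sT] sT'] siT] siT'].
have s'G : normal_seq G (s \o phi).
  split=> // [nu|nu mu nm]; first exact: sG.
  by apply: s_neq => /(strict_incr_inj hphi).
have siG : normal_seq G (fun nu => invmx (s (phi nu))).
  split=> // [nu|nu mu nm /(proj_eq_invmx (su _))]; first exact: Ginv.
  by apply: s_neq => /(strict_incr_inj hphi).
have svd' nu : is_svd ((s \o phi) nu) ((U \o phi) nu) ((a \o phi) nu) ((W \o phi) nu).
  exact: s_svd.
have r00 : r0 = 0.
  by apply: (middle_ratio_cvg0 s'G svd' UU0 WW0 rr0 Bn) => v /BD /DG.
rewrite r00 in rr0.
have f1 : frame n 1 0 *m (frame n 1 0)^T = 1%:M.
  by apply: frame_right_inverse; rewrite mulr1 mulr0 addr0.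
have fD (b : 'rV[C]_(dim2 n)) :
    frame n 1 0 *m diag_mx b = diag_mx (\row_i b 0 (lo i)) *m frame n 1 0.
  by apply: frame_diag; rewrite mul0r mulr0.
have U0u : U0 \is unitarymx.
  by apply: cvg_unitarymx UU0 => nu; have [[]] := svd' nu.
(* [BI] is the limit of the leading right singular planes. [BK] is the same plane for the inverses,
   whose right factor is [rev_mx] times the adjoint of [U]. *)
exists (frame n 1 0 *m W0), (frame n 1 0 *m (rev_mx _ *m U0 ^t*)), phi; split => //.
- apply: (limit_plane_frame (Q := fun=> frame n 1 0) s'G svd' UU0 WW0 (cvg_cst _) _ f1).
  by move=> nu; exact: fD.
- apply: (limit_plane_frame (Q := fun=> frame n 1 0) siG
    (fun nu => is_svd_inv (svd' nu)) _ _ (cvg_cst _) _ f1).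
  + by apply: (cvg_mulmx (cvg_conj_trmx WW0)); exact: cvg_cst.
  + by apply: cvg_mulmx (cvg_conj_trmx UU0); exact: cvg_cst.
  + by move=> nu; exact: fD.
move=> M V Mc MK; apply: (svd_converges svd' UU0 WW0 rr0 Mc) => v Mv.
(* If the first n+1 coordinates of [v *m U0] vanish, reversal moves the zeros beyond index n, so [v]
   lies in [BK], contrary to disjointness. *)
apply: contrapT => vU0.
suff : (M `&` pts (frame n 1 0 *m (rev_mx _ *m U0 ^t*))) v by rewrite MK.
split=> //; split; first by have [] := Mc.1 v Mv.
have -> : v = v *m U0 *m rev_mx _ *m (rev_mx _ *m U0 ^t*).
  rewrite !mulmxA -(mulmxA (v *m U0)) rev_mxK mulmx1 -invmx_unitary //.
  by rewrite mulmxK // unitarymx_unit.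
apply/submxMr/sub_frame10 => j lt_j; rewrite mulmx_rev.
have lt_rev : (rev_ord j < n.+1)%N.
  rewrite /= ltnS leq_subLR; apply: (@leq_trans (n.+2 + n)).
    by rewrite !addSn addnn.
  by rewrite leq_add2r.
apply/eqP; apply: contrapT => /negP vj; apply: vU0.
by exists (Ordinal lt_rev); rewrite (_ : lo _ = rev_ord j) //; exact: val_inj.
Qed.
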